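(* There is an absolute constant $c>0$ such that every zebra function $f:\{0,1\}^n\to\{0,1\}$ satisfies (1) $\mathrm{D}(f)\le c\,\mathrm{bs}(f)^2$, and (2) $\mathrm{C}(f)\le c\,\deg(f)^2$.
   Context: For $x,y\in\{0,1\}^n$, $x\le y$ means $x_i\le y_i$ for all $i$. A monotone path from $p$ to $q$ ($p\le q$) is a sequence $p=x^{(1)},\dots,x^{(k)}=q$ in $\{0,1\}^n$ where each $x^{(i+1)}$ is obtained from $x^{(i)}$ by changing a single $0$-bit to $1$. The alternation number of such a path with respect to $f$ is the number of indices $i$ with $f(x^{(i)})\ne f(x^{(i+1)})$. $f$ is a zebra function if all monotone paths from $0^n$ to $1^n$ have the same alternation number with respect to $f$. $\mathrm{D}(f)$ is the minimum depth of a deterministic decision tree (querying single input bits) computing $f$. For $B\subseteq[n]$, $x^{\oplus B}$ is $x$ with bits in $B$ flipped; $B$ is a sensitive block of $x$ if $f(x^{\oplus B})\ne f(x)$; $\mathrm{bs}(f)=\max_x$ (maximum number of pairwise disjoint sensitive blocks of $x$). $\deg(f)$ is the degree of the unique multilinear real polynomial agreeing with $f$ on $\{0,1\}^n$. A subcube is a set $\{y: y_i=a_i\ \forall i\in I\}$ for some $I\subseteq[n]$ and $a\in\{0,1\}^I$; its co-dimension is $|I|$. $\mathrm{C}(f,x)$ is the minimum co-dimension of a subcube containing $x$ on which $f$ is constant, and $\mathrm{C}(f)=\max_x \mathrm{C}(f,x)$. *)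

(* Defs.v *)
From mathcomp Require Import all_boot all_order all_algebra.
From mathcomp Require Import boolp reals.
From mathcomp Require Import mpoly.

Set Implicit Arguments.
Unset Strict Implicit.
Unset Printing Implicit Defensive.

Import GRing.Theory.
Local Open Scope ring_scope.

Notation input n := {ffun 'I_n -> bool}.

Section BooleanFunctions.
Variable n : nat.
Implicit Types (x y p q : input n) (f : input n -> bool) (B I : {set 'I_n}).

Definition all0 : input n := [ffun _ => false].
Definition all1 : input n := [ffun _ => true].

Definition flip x B : input n := [ffun i => (i \in B) (+) x i].

Definition mono_step : rel (input n) :=
  fun x y => [exists i, ~~ x i && (y == flip x [set i])].

(* As in [path], a path is given by its first point and the sequence of its
   remaining points. *)
Definition monotone_path p q (s : seq (input n)) : bool :=
  path mono_step p s && (last p s == q).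

Definition alternation f p (s : seq (input n)) : nat :=
  count id (pairmap (fun x y => f x != f y) p s).

Definition zebra f : Prop :=
  forall s t, monotone_path all0 all1 s -> monotone_path all0 all1 t ->
  alternation f all0 s = alternation f all0 t.

(* [Query i t0 t1] continues with [t0] if the queried bit is 0 and with [t1]
   if it is 1. *)
Inductive dtree : Type :=
  | Leaf of bool
  | Query of 'I_n & dtree & dtree.

Fixpoint dt_eval (t : dtree) x : bool :=
  match t with
  | Leaf b => b
  | Query i t0 t1 => if x i then dt_eval t1 x else dt_eval t0 x
  end.

Fixpoint dt_depth (t : dtree) : nat :=
  match t with
  | Leaf _ => 0
  | Query _ t0 t1 => (maxn (dt_depth t0) (dt_depth t1)).+1
  end.

Definition dt_computes (t : dtree) f : Prop := forall x, dt_eval t x = f x.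

Lemma dtree_exists f : exists t, dt_computes t f.
Proof.
suff H (s : seq 'I_n) (g : input n -> bool) :
    (forall x y, {in s, x =1 y} -> g x = g y) -> exists t, dt_computes t g.
  apply: (H (enum 'I_n)) => x y exy; congr f; apply/ffunP => i.
  by apply: exy; rewrite mem_enum.
elim: s g => [|i s IH] g Hg.
  by exists (Leaf (g all0)) => x /=; apply: Hg.
pose set_bit b x : input n := [ffun j => if j == i then b else x j].
have Hb b : exists t, dt_computes t (g \o set_bit b).
  apply: IH => x y exy /=; apply: Hg => j; rewrite inE !ffunE.
  by case: eqVneq => //= _; apply: exy.
have [[t0 H0] [t1 H1]] := (Hb false, Hb true).
exists (Query i t0 t1) => x /=; rewrite H0 H1 /=.
by case E: (x i); congr g; apply/ffunP => j; rewrite ffunE;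
   case: eqVneq => // ->.
Qed.

Lemma dt_depth_exists f :
  exists d, `[< exists t, dt_computes t f /\ dt_depth t = d >].
Proof.
by have [t Ht] := dtree_exists f; exists (dt_depth t); apply/asboolP; exists t.
Qed.

Definition D f : nat := ex_minn (dt_depth_exists f).

Definition sensitive_block f x B : bool := f (flip x B) != f x.

(* Sensitive blocks are nonempty, hence pairwise disjoint ones are distinct:
   a family of them is a set of sets. *)
Definition bs_at f x : nat :=
  \max_(P : {set {set 'I_n}} |
        trivIset P && [forall B in P, sensitive_block f x B]) #|P|.

Definition bs f : nat := \max_x bs_at f x.

(* Only the values of [a] on [I] matter. *)
Definition subcube I (a : input n) : {set input n} :=
  [set y : input n | [forall i in I, y i == a i]].

Definition constant_on f (S : {set input n}) : bool :=
  [forall y in S, forall z in S, f y == f z].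

Definition certifies f x I : bool :=
  [exists a, (x \in subcube I a) && constant_on f (subcube I a)].

Lemma certifiesT f x : certifies f x setT.
Proof.
have subT y : y \in subcube setT x -> y = x.
  rewrite inE => /forall_inP yx; apply/ffunP => i.
  by apply/eqP/yx; rewrite inE.
apply/existsP; exists x; rewrite inE; apply/andP; split; first exact/forall_inP.
by apply/forall_inP => y /subT ->; apply/forall_inP => z /subT ->.
Qed.

Definition C_at f x : nat :=
  #|[arg min_(I < setT | certifies f x I) #|I|]|.

Lemma C_atP f x :
  (exists2 I, certifies f x I & #|I| = C_at f x) /\
  (forall I, certifies f x I -> (C_at f x <= #|I|)%N).
Proof.
rewrite /C_at; case: arg_minnP => [|I cI minI]; first exact: certifiesT.
by split; first by exists I.
Qed.

Definition C f : nat := \max_x C_at f x.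

Variable R : realType.
Implicit Type P : {mpoly R[n]}.

Definition multilinear P : bool :=
  all (fun m : 'X_{1..n} => [forall i, (m i <= 1)%N]) (msupp P).

Definition cube_point x : 'I_n -> R := fun i => (x i)%:R.

Definition agrees P f : bool :=
  [forall x, P.@[cube_point x] == (f x)%:R].

Definition set_mnm B : 'X_{1..n} := [multinom (i \in B : nat) | i < n].

Lemma multilinearP P :
  reflect (forall m, m \in msupp P -> forall i, (m i <= 1)%N) (multilinear P).
Proof. by apply: (iffP allP) => H m /H => [/forallP|?]; last exact/forallP. Qed.

Lemma multilinear_sum (T : Type) (r : seq T) (F : T -> {mpoly R[n]}) :
  (forall t, multilinear (F t)) -> multilinear (\sum_(t <- r) F t).
Proof.
move=> HF; elim/big_rec: _ => [|t Q _ /multilinearP HQ].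
  by rewrite /multilinear msupp0.
apply/multilinearP => m /msuppD_le; rewrite mem_cat => /orP[|/HQ //].
by move: m; apply/multilinearP.
Qed.

Lemma multilinearZ c P : multilinear P -> multilinear (c *: P).
Proof.
by move=> /multilinearP HP; apply/multilinearP => m /msuppZ_le; apply: HP.
Qed.

Lemma multilinear_set_mnm B : multilinear 'X_[set_mnm B].
Proof.
apply/multilinearP => m; rewrite msuppX inE => /eqP -> i.
by rewrite mnmE leq_b1.
Qed.

Lemma mlpoly_exists f : exists P, multilinear P && agrees P f.
Proof.
pose a x i : R := (~~ x i)%:R; pose b x i : R := (x i)%:R - (~~ x i)%:R.
pose mono x B : {mpoly R[n]} :=
  (\prod_i (if i \in B then b x i else a x i)) *: 'X_[set_mnm B].
exists (\sum_x (f x)%:R *: \sum_(B : {set 'I_n}) mono x B).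
apply/andP; split.
  apply: multilinear_sum => x; apply/multilinearZ/multilinear_sum => B.
  exact/multilinearZ/multilinear_set_mnm.
apply/forallP => y; apply/eqP; rewrite raddf_sum /=.
have E x : (\sum_(B : {set 'I_n}) mono x B).@[cube_point y] = (x == y)%:R.
  rewrite raddf_sum /=.
  transitivity (\prod_i (b x i * cube_point y i + a x i)).
    rewrite bigA_distr; apply: eq_bigr => B _.
    rewrite mevalZ mevalX -big_split /=; apply: eq_bigr => i _.
    by rewrite mnmE; case: (i \in B); rewrite ?expr1 ?expr0 ?mulr1.
  rewrite /a /b /cube_point; case: eqVneq => [->|nxy].
    by apply: big1 => i _; case: (y i) => /=; rewrite ?subr0 ?sub0r ?mulr1 ?mulr0 ?addr0 ?add0r.
  have [i ni] : exists i, x i != y i.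
    apply/existsP; rewrite -negb_forall; apply: contra nxy => /forallP H.
    by apply/eqP/ffunP => i; apply/eqP.
  rewrite (bigD1 i) //=.
  suff -> : ((x i)%:R - (~~ x i)%:R) * (y i)%:R + (~~ x i)%:R = 0 :> R.
    by rewrite mul0r.
  by case: (x i) (y i) ni => [] [] //= _;
     rewrite ?mulr0 ?sub0r ?mulr1 ?addNr ?addr0.
rewrite (bigD1 y) //= mevalZ E eqxx mulr1 big1 ?addr0 // => x nxy.
by rewrite mevalZ E (negPf nxy) mulr0.
Qed.

Lemma mlpoly_unique f P Q :
  multilinear P -> agrees P f -> multilinear Q -> agrees Q f -> P = Q.
Proof.
move=> /multilinearP mP /forallP aP /multilinearP mQ /forallP aQ.
apply/eqP; rewrite -subr_eq0; apply/negPn/negP => nz.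
set S := P - Q in nz *.
have mS m : m \in msupp S -> forall i, (m i <= 1)%N.
  by move=> /msuppB_le; rewrite mem_cat => /orP[/mP|/mQ].
have zS x : S.@[cube_point x] = 0.
  by rewrite mevalB (eqP (aP x)) (eqP (aQ x)) subrr.
have exS : exists k, has (fun m => mdeg m == k) (msupp S).
  case E: (msupp S) => [|m s]; first by rewrite -msupp_eq0 E in nz.
  by exists (mdeg m); rewrite /= eqxx.
have [k /hasP[m0 m0S /eqP <-] kmin] := ex_minnP exS.
have := zS [ffun i => (0 < m0 i)%N].
rewrite mevalE (bigD1_seq m0) //= ?msupp_uniq //.
rewrite [X in _ * X + _]big1 => [|i _]; last first.
  rewrite /cube_point ffunE.
  by case: (posnP (m0 i)) => [->|_]; rewrite ?expr0 ?expr1n.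
rewrite mulr1 big_seq_cond big1 ?addr0.
  by move/eqP; rewrite mcoeff_eq0 m0S.
move=> m /andP[mS' nm]; have lem : (mdeg m0 <= mdeg m)%N.
  by apply: kmin; apply/hasP; exists m.
have [i mi] : exists i, (m0 i < m i)%N.
  apply/existsP; apply: contraNT nm; rewrite negb_exists => /forallP H.
  apply/eqP/mnmP.
  have le i : (m i <= m0 i)%N by rewrite leqNgt.
  move=> i; apply/eqP; rewrite eqn_leq le /= leqNgt; apply/negP => lt.
  have : (mdeg m < mdeg m0)%N.
    rewrite !mdegE (bigD1 i) //= [X in (_ < X)%N](bigD1 i) //= -addSn.
    by rewrite leq_add // leq_sum.
  by rewrite ltnNge lem.
have z0 : m0 i = 0%N by have := leq_trans mi (mS _ mS' i); rewrite ltnS leqn0 => /eqP.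
rewrite (bigD1 i) //= /cube_point ffunE z0 ltnn expr0n.
by rewrite z0 in mi; rewrite (gtn_eqF mi) mul0r mulr0.
Qed.

Definition mlpoly f : {mpoly R[n]} := xchoose (mlpoly_exists f).

Lemma mlpolyP f : multilinear (mlpoly f) && agrees (mlpoly f) f.
Proof. exact: xchooseP (mlpoly_exists f). Qed.

(* [msize] is the total degree plus one, and 0 for the zero polynomial, whose
   degree is thus taken to be 0. *)
Definition deg f : nat := (msize (mlpoly f)).-1.

End BooleanFunctions.

Arguments deg {n} R f.
Arguments mlpoly {n} R f.

(* Main.v *)
(** For a zebra function [f], the number [a x] of alternations along a monotone
path from 0 to [x] depends only on [x]; [a] is monotone, and grows along an
edge of the cube exactly when [f] changes.  Given [x], take [y] minimal below
[x] and [z] maximal above [x] with [a y = a z = a x].  On the interval from [y]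
to [z], [a] and hence [f] are constant, so the ones of [y] and the zeros of [z]
certify [f x]; by extremality [y] is sensitive at each of its ones and [z] at
each of its zeros.  Hence C(f) <= 2 s(f), where s is sensitivity.

Since s <= bs, the first bound follows from D(f) <= C(f) bs(f) (Beals, Buhrman,
Cleve, Mosca, de Wolf).  The second one follows from s(f) <= 6 deg(f)^2:
symmetrizing [f] over the sensitive bits of a point gives a univariate
polynomial that takes values in [0,1] on {0, ..., s} and jumps by 1 between 0
and 1.  Interpolation at the points 6 i^2, for 1 <= i <= deg(f), in place of
Markov's inequality, shows that s cannot exceed 6 deg(f)^2. *)

Require Import Defs.
From mathcomp Require Import all_boot all_order all_algebra.
From mathcomp Require Import boolp reals mpoly qpoly zify ring lra.

Set Implicit Arguments.
Unset Strict Implicit.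
Unset Printing Implicit Defensive.

Import Order.TTheory GRing.Theory Num.Theory.

(** * Decision trees built from certificates: [D f <= C f * bs f] *)

Section Trees.
Variable n : nat.
Implicit Types (f : input n -> bool) (x y a : input n) (I Q B : {set 'I_n}).

(** A complete tree queries [s], and the tree for the answers received is grafted at each leaf. [X]
    carries what is already known of the input; the induction adds one answer to it. *)
Lemma dtree_query (s : seq 'I_n) f d (X : input n -> Prop) :
  (forall a, exists2 t, (dt_depth t <= d)%N &
     forall y, X y -> {in s, y =1 a} -> dt_eval t y = f y) ->
  exists2 t, (dt_depth t <= size s + d)%N & forall y, X y -> dt_eval t y = f y.
Proof.
elim: s X => [|i s IH] X HX.
  by have [t dt tE] := HX (all0 n); exists t => // y Xy; apply: tE.
have Hb b : exists2 t, (dt_depth t <= size s + d)%N &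
    forall y, X y /\ y i = b -> dt_eval t y = f y.
  apply: IH => a.
  have [t dt tE] := HX [ffun j => if j == i then b else a j].
  exists t => // y [Xy yi] ya; apply: tE => // j; rewrite inE ffunE.
  by case: eqVneq => [->|_] //=; apply: ya.
have [[t0 d0 E0] [t1 d1 E1]] := (Hb false, Hb true).
exists (Query i t0 t1) => [|y Xy] /=; first by rewrite addSn ltnS geq_max d0.
by case yi: (y i); [apply: E1 | apply: E0].
Qed.

Lemma in_subcubeP I a y : reflect {in I, y =1 a} (y \in subcube I a).
Proof. by rewrite inE; apply: (iffP forall_inP) => H i /H; [move/eqP | move->]. Qed.

Lemma certifiesP f x I :
  reflect (forall y, {in I, y =1 x} -> f y = f x) (certifies f x I).
Proof.
apply: (iffP existsP) => [[a /andP[/in_subcubeP xa /forall_inP cst]] y yx | H].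
  have xI : x \in subcube I a by apply/in_subcubeP.
  have yI : y \in subcube I a by apply/in_subcubeP => i iI; rewrite yx ?xa.
  by have /forall_inP/(_ x xI)/eqP := cst y yI.
exists x; apply/andP; split; first exact/in_subcubeP.
by apply/forall_inP => y /in_subcubeP/H ->; apply/forall_inP => z /in_subcubeP/H ->.
Qed.

Lemma flip_disagreement x y : flip y [set i | x i != y i] = x.
Proof. by apply/ffunP => i; rewrite ffunE inE; case: (x i); case: (y i). Qed.

(* [b] bounds the number of disjoint sensitive blocks, outside the queried bits
   [Q], of the inputs with value 0.  Querying a certificate [I] of an input [x]
   with value 1 lowers it: flipping the bits of [I] where [y] differs from [x]
   makes [f y] true, so these bits form one more sensitive block of [y]. *)
Lemma dtree_certificates f k (cert : forall x, exists2 I, certifies f x I & #|I| <= k)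
    b Q a :
  (forall y (P : {set {set 'I_n}}), {in Q, y =1 a} -> f y = false -> trivIset P ->
     {in P, forall B, sensitive_block f y B /\ [disjoint B & Q]} -> #|P| <= b) ->
  exists2 t, (dt_depth t <= k * b)%N & forall y, {in Q, y =1 a} -> dt_eval t y = f y.
Proof.
elim: b Q a => [|b IH] Q a blocks.
  have [[y ya fy]|no0] :=
      pselect (exists2 y : input n, {in Q, y =1 a} & f y = false); last first.
    exists (Leaf n true) => // y ya /=.
    by case fy: (f y) => //; case: no0; exists y.
  exists (Leaf n false) => // z za /=; apply/esym/negP => fz.
  (* The bits where [y] and [z] differ form a sensitive block of [y] outside [Q], against the bound
     0. *)
  have := blocks y [set [set i | z i != y i]] ya fy.
  rewrite cards1 => H; suff : 1 <= 0 by []; apply: H.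
    by apply/trivIsetP => A B /set1P -> /set1P ->; rewrite eqxx.
  move=> B /set1P ->; rewrite /sensitive_block flip_disagreement fy fz; split=> //.
  rewrite disjoint_subset; apply/subsetP => i; rewrite !inE.
  by apply: contra => iQ; rewrite ya ?za.
have [[x xa fx]|no1] := pselect (exists2 x : input n, {in Q, x =1 a} & f x); last first.
  exists (Leaf n false) => // y ya /=.
  by case fy: (f y) => //; case: no1; exists y.
have [I /certifiesP cI leI] := cert x.
suff [t dt tE] : exists2 t, (dt_depth t <= size (enum I) + k * b)%N &
    forall y, {in Q, y =1 a} -> dt_eval t y = f y.
  by exists t => //; apply: leq_trans dt _; rewrite mulnS leq_add2r -cardE.
(* The new answers [a'] may contradict [a] on [Q]; there the old ones prevail. *)
apply: dtree_query => a'; pose a'' : input n := [ffun i => if i \in Q then a i else a' i].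
have [|t dt tE] := IH (Q :|: I) a''; last first.
  exists t => // y ya ya'; apply: tE => i; rewrite inE ffunE.
  by case: ifP => [iQ _|_ /= iI]; [apply: ya | apply: ya'; rewrite mem_enum].
move=> y P ya'' fy trivP sensP.
have ya : {in Q, y =1 a} by move=> i iQ; rewrite ya'' ?inE ?iQ // ffunE iQ.
pose B0 := [set i in I | x i != y i].
have sB0 : sensitive_block f y B0.
  rewrite /sensitive_block fy (cI _ _) ?fx // => i iI.
  by rewrite ffunE inE iI; case: (x i); case: (y i).
have B0Q : [disjoint B0 & Q].
  rewrite disjoint_subset; apply/subsetP => i; rewrite !inE => /andP[_].
  by apply: contra => iQ; rewrite ya ?xa.
have B0I : B0 \subset I by apply/subsetP => i; rewrite inE => /andP[].
have PB0 B : B \in P -> [disjoint B0 & B].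
  move=> /sensP[_]; rewrite disjoint_sym; apply: disjointWl.
  by apply: subset_trans B0I _; apply: subsetUr.
(* Being sensitive, [B0] is nonempty, so it cannot be disjoint from itself. *)
have B0P : B0 \notin P.
  apply/negP => /PB0; rewrite -setI_eq0 setIid => /eqP E0.
  move: sB0; rewrite /sensitive_block E0 (_ : flip y set0 = y) ?eqxx //.
  by apply/ffunP => i; rewrite ffunE inE.
suff : #|B0 |: P| <= b.+1 by rewrite cardsU1 B0P.
apply: (blocks y) => //.
  apply/trivIsetP => A B /setU1P[->|AP] /setU1P[->|BP]; rewrite ?eqxx // => AB.
  - exact: PB0.
  - by rewrite disjoint_sym PB0.
  - by move/trivIsetP: trivP; apply.
move=> B /setU1P[->|/sensP[sB dB]] //; split=> //.
by apply: disjointWr dB; apply: subsetUl.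
Qed.

Lemma D_le_C_bs f : (D f <= C f * bs f)%N.
Proof.
have cert x : exists2 I, certifies f x I & #|I| <= C f.
  by have [[I cI EI] _] := C_atP f x; exists I; rewrite // EI /C leq_bigmax.
have [|t dt tE] := @dtree_certificates f _ cert (bs f) set0 (all0 n).
  move=> y P _ _ trivP sensP; apply: leq_trans (leq_bigmax y); apply: leq_bigmax_cond.
  by rewrite trivP; apply/forall_inP => B /sensP[].
rewrite /D; case: ex_minnP => d _ mind; apply: leq_trans dt.
by apply: mind; apply/asboolP; exists t; split=> // x; apply: tE => i; rewrite inE.
Qed.

Lemma sensitive_bits_le_bs f x B :
  (forall i, i \in B -> sensitive_block f x [set i]) -> (#|B| <= bs f)%N.
Proof.
move=> sens; apply: leq_trans (leq_bigmax x).
rewrite -(card_imset (mem B) set1_inj).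
apply: leq_bigmax_cond; apply/andP; split.
  apply/trivIsetP => _ _ /imsetP[i _ ->] /imsetP[j _ ->] ij.
  by rewrite disjoints1 inE; apply: contra ij => /eqP ->.
by apply/forall_inP => _ /imsetP[i iB ->]; apply: sens.
Qed.

End Trees.

(** * The rank of a zebra function and the certificates drawn from it *)

Section Zebra.
Variable n : nat.
Implicit Types (f : input n -> bool) (x y z w : input n).

Definition le_input x y : bool := [forall i, x i ==> y i].

Lemma le_inputP x y : reflect (forall i, x i -> y i) (le_input x y).
Proof. by apply: (iffP forallP) => H i; apply/implyP; apply: H. Qed.

(** Induction on the number of bits where [x] and [z] differ: [x] climbs one bit at a time towards a
    fixed [z]. *)
Lemma le_input_ind (P : input n -> input n -> Prop) :
  (forall x, P x x) ->
  (forall x z i, ~~ x i -> z i -> P (flip x [set i]) z -> P x z) ->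
  forall x z, le_input x z -> P x z.
Proof.
move=> P0 PS x z; move: {2}#|[set i | x i != z i]| (leqnn #|[set i | x i != z i]|) => m.
elim: m x => [|m IH] x.
  rewrite leqn0 cards_eq0 => /eqP/setP E _.
  suff -> : x = z by [].
  by apply/ffunP => i; have := E i; rewrite !inE => /negbFE/eqP.
move=> lem /le_inputP xz.
have [E|[i]] := set_0Vmem [set i | x i != z i].
  by apply: IH; rewrite ?E ?cards0 //; apply/le_inputP.
rewrite inE => xzi.
have /andP[xi zi] : ~~ x i && z i.
  by have := xz i; move: xzi; case: (x i); case: (z i) => // _ /(_ isT).
apply: (PS _ _ i) => //; apply: IH; last first.
  apply/le_inputP => j; rewrite ffunE inE.
  by case: eqVneq => [-> //|_]; rewrite addFb; apply: xz.
rewrite -ltnS; apply: leq_trans lem; apply: proper_card; apply/properP; split.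
  apply/subsetP => j; rewrite !inE ffunE inE; case: (eqVneq j i) => [->|//].
  by rewrite xzi.
by exists i; rewrite !inE ?xzi // ffunE inE eqxx (negPf xi) zi.
Qed.

Lemma monotone_path_exists x z : le_input x z -> exists s, monotone_path x z s.
Proof.
move: x z; apply: le_input_ind => [x|x z i xi _ [s /andP[ps ls]]].
  by exists [::]; rewrite /monotone_path /= eqxx.
exists (flip x [set i] :: s); rewrite /monotone_path /= ps ls !andbT.
by apply/existsP; exists i; rewrite xi eqxx.
Qed.

Lemma zebra_rank f : zebra f ->
  exists a : input n -> nat, forall x i, ~~ x i ->
    a (flip x [set i]) = (f x != f (flip x [set i])) + a x.
Proof.
move=> zf.
have le0 x : le_input (all0 n) x by apply/le_inputP => i; rewrite ffunE.
have le1 x : le_input x (all1 n) by apply/le_inputP => i; rewrite ffunE.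
have [s sP] := choice (fun x => monotone_path_exists (le0 x)).
exists (fun x => alternation f (all0 n) (s x)) => x i xi.
set y := flip x [set i].
have [t /andP[pt lt]] := monotone_path_exists (le1 y).
have [/andP[px /eqP lx] /andP[py /eqP ly]] := (sP x, sP y).
(* Two full paths through [y] with the same end [t]; cancelling [t] compares the two ways of
   reaching [y]. *)
have := zf (s x ++ y :: t) (s y ++ t).
rewrite /monotone_path !cat_path !last_cat /= px lx py ly pt lt !andbT.
have -> : mono_step x y by apply/existsP; exists i; rewrite xi eqxx.
move=> /(_ isT isT); rewrite /alternation !pairmap_cat !count_cat lx ly /=.
by rewrite addnA => /addIn; rewrite addnC.
Qed.

Lemma flipK x (B : {set 'I_n}) : flip (flip x B) B = x.
Proof. by apply/ffunP => i; rewrite !ffunE addbA addbb. Qed.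

Section Rank.
Variables (f : input n -> bool) (a : input n -> nat).
Hypothesis rankS : forall x i, ~~ x i ->
  a (flip x [set i]) = (f x != f (flip x [set i])) + a x.

(** A step that changes [f] makes the rank strictly larger, and no later step lowers it. *)
Lemma rank_le x z : le_input x z -> a x <= a z /\ (a x = a z -> f x = f z).
Proof.
move: x z; apply: le_input_ind => [//|x z i xi _ []]; rewrite rankS //.
case: eqP => [->|_] //= lt _; split; first by lia.
by lia.
Qed.

Lemma rank_certificate k :
  (forall x (B : {set 'I_n}),
     (forall i, i \in B -> sensitive_block f x [set i]) -> #|B| <= k) ->
  C f <= 2 * k.
Proof.
move=> sens; apply/bigmax_leqP => x _.
have refl w : le_input w w by apply/le_inputP.
pose ones w := [set i : 'I_n | w i]; pose zeros w := [set i : 'I_n | ~~ w i].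
have [y /andP[/le_inputP yx /eqP ay] ymin] :=
  @arg_minnP _ x (fun y => le_input y x && (a y == a x)) (fun y => #|ones y|)
    (introT andP (conj (refl x) (eqxx _))).
have [z /andP[/le_inputP xz /eqP az] zmin] :=
  @arg_minnP _ x (fun z => le_input x z && (a z == a x)) (fun z => #|zeros z|)
    (introT andP (conj (refl x) (eqxx _))).
(* Clearing a one of [y] without changing [f] would keep the rank and leave fewer ones. *)
have ley : #|ones y| <= k.
  apply: (sens y) => i; rewrite inE => yi; rewrite /sensitive_block.
  set y' := flip y [set i].
  have yE : flip y' [set i] = y by apply: flipK.
  have y'i : ~~ y' i by rewrite ffunE inE eqxx yi.
  have := rankS y'i; rewrite yE; case: eqP => //= _; rewrite add0n => ayE.
  have : #|ones y| <= #|ones y'|.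
    apply: ymin; rewrite -ayE ay eqxx andbT; apply/le_inputP => j.
    by rewrite ffunE inE; case: eqVneq => [->|_]; [rewrite yi | apply: yx].
  rewrite leqNgt => /negP; case; apply: proper_card; apply/properP; split.
    apply/subsetP => j; rewrite !inE ffunE inE.
    by case: (eqVneq j i) => [->|//]; rewrite yi.
  by exists i; rewrite !inE ?yi //.
have lez : #|zeros z| <= k.
  apply: (sens z) => i; rewrite inE => zi; rewrite /sensitive_block eq_sym.
  have := rankS zi; case: eqP => //= _; rewrite add0n => azE.
  have : #|zeros z| <= #|zeros (flip z [set i])|.
    apply: zmin; rewrite azE az eqxx andbT; apply/le_inputP => j xj.
    by rewrite ffunE inE; case: eqVneq => [->|_]; [rewrite (negPf zi) | apply: xz].
  rewrite leqNgt => /negP; case; apply: proper_card; apply/properP; split.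
    apply/subsetP => j; rewrite !inE ffunE inE.
    by case: (eqVneq j i) => [->|//]; rewrite zi.
  by exists i; rewrite !inE ?zi // ffunE inE eqxx (negPf zi).
have [_ minC] := C_atP f x.
apply: leq_trans (minC (ones y :|: zeros z) _) _; last first.
  by apply: leq_trans (leq_card_setU _ _) _; rewrite mul2n -addnn leq_add.
apply/certifiesP => w wx.
(* Agreeing with [x] on the certificate places [w] between [y] and [z], so its rank is squeezed
   between two equal values. *)
have yw : le_input y w by apply/le_inputP => i yi; rewrite wx ?inE ?yi //; apply: yx.
have wz : le_input w z.
  apply/le_inputP => i; apply: contraTT => zi; rewrite wx ?inE ?zi ?orbT //.
  by apply: contra zi; apply: xz.
have [[ayw fyw] [awz _]] := (rank_le yw, rank_le wz).
have [_ fyx] := rank_le (introT (le_inputP _ _) yx).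
by rewrite -fyw -?fyx //; lia.
Qed.

End Rank.

(** The sensitivity bound [k] stays abstract, to be taken as [bs f] and as [6 * deg R f ^ 2]. *)
Lemma zebra_C_le f k : zebra f ->
  (forall x (B : {set 'I_n}),
     (forall i, i \in B -> sensitive_block f x [set i]) -> #|B| <= k) ->
  C f <= 2 * k.
Proof. by move=> /zebra_rank[a /rank_certificate]; apply. Qed.

End Zebra.

Local Open Scope ring_scope.

(** * Lagrange interpolation at the points 6 i^2 *)

Section Interpolation.
Variable R : realFieldType.

(** As (i+1)^2 - (j+1)^2 = (i-j)(i+j+2), the product is i!/(i-d)! times (i+1+d)!/(i+1)!. *)
Lemma prod_dist_sqr_lt (i d : nat) : (d <= i)%N ->
  (\prod_(j < d | j != i :> nat) `|i.+1%:R ^+ 2 - j.+1%:R ^+ 2|) *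
    ((i - d)`! * i.+1`!)%:R = (i`! * (i.+1 + d)`!)%:R :> R.
Proof.
elim: d => [|d IH] ltdi.
  by rewrite big_ord0 mul1r subn0 addn0.
rewrite big_mkcond big_ord_recr -big_mkcond /= ltn_eqF //=.
have Ef : (i - d)`! = ((i - d) * (i - d.+1)`!)%N by rewrite -(subnSK ltdi) factS.
rewrite addnS (factS (i.+1 + d)); have := IH (ltnW ltdi); rewrite Ef.
move: (i - d.+1)`! i.+1`! (i.+1 + d)`! => F1 F2 F3; rewrite ger0_norm; last first.
  by rewrite subr_ge0 -!natrX ler_nat leq_exp2r // ltnS ltnW.
rewrite !natrM natrB 1?ltnW // => E.
rewrite [(i.+1 + d).+1%:R]mulrS natrD [RHS]mulrCA -E -!natr1; ring.
Qed.

(** Induction on [d] from [i.+1], where the previous lemma at [d = i] applies. In 2(i+1)^2, the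
    factor 2(i+1) is the value of i+j+2 at the omitted j = i, and the other i+1 comes from
    i!/(i+1)!. *)
Lemma prod_dist_sqr (i d : nat) : (i < d)%N ->
  (2 * i.+1%:R ^+ 2) *
    (\prod_(j < d | j != i :> nat) `|i.+1%:R ^+ 2 - j.+1%:R ^+ 2|) =
  ((d - i.+1)`! * (d + i.+1)`!)%:R :> R.
Proof.
move=> /subnK <-; move: (d - i.+1)%N => e {d}.
rewrite addnK; elim: e => [|e IH].
  have := prod_dist_sqr_lt (leqnn i).
  rewrite big_mkcond [in X in _ -> X]big_mkcond add0n big_ord_recr /= eqxx mulr1 subnn.
  rewrite mul1n (factS i) addnS (factS (i.+1 + i)).
  move: (i.+1 + i)`! => F; rewrite !natrM => E.
  have i0 : i`!%:R != 0 :> R by rewrite pnatr_eq0 -lt0n fact_gt0.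
  apply: (mulfI i0); rewrite fact0 mul1r [RHS]mulrCA -E.
  by rewrite [(i.+1 + i).+1%:R]mulrS natrD -!natr1; ring.
rewrite big_mkcond addSn big_ord_recr -big_mkcond /= gtn_eqF ?leq_addl //=.
rewrite mulrA IH (factS e) addSn (factS (e + i.+1 + i.+1)).
move: e`! (e + i.+1 + i.+1)`! => F1 F2; rewrite !natrM distrC ger0_norm; last first.
  by rewrite subr_ge0 -!natrX ler_nat leq_exp2r // ltnS addnS leqW ?leq_addl.
by rewrite [(_ + _).+1%:R]mulrS !natrD -!natr1; ring.
Qed.

(** Passing from [k] to [k.+1] replaces a factor d-k by the larger d+k+1. *)
Lemma fact_sqr_le (d k : nat) : (k <= d)%N ->
  (d`! * d`! <= (d - k)`! * (d + k)`!)%N.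
Proof.
elim: k => [|k IH] ltkd; first by rewrite subn0 addn0.
apply: leq_trans (IH (ltnW ltkd)) _.
have -> : (d - k)`! = ((d - k) * (d - k.+1)`!)%N by rewrite -(subnSK ltkd) factS.
rewrite addnS (factS (d + k)) -mulnA [leqRHS]mulnCA leq_mul2r.
by apply/orP; right; lia.
Qed.

Lemma prod_sqr (i d : nat) : (i < d)%N ->
  i.+1%:R ^+ 2 * \prod_(j < d | j != i :> nat) j.+1%:R ^+ 2 = (d`!%:R) ^+ 2 :> R.
Proof.
move=> ltid; rewrite fact_prod big_add1 big_mkord natr_prod -prodrXl.
by rewrite [RHS](bigD1 (Ordinal ltid)).
Qed.

(** Multiplied by (i+1)^2, the two sides become d!^2 and (d-i-1)!(d+i+1)!. *)
Lemma prod_ratio_le2 (i d : nat) : (i < d)%N ->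
  \prod_(j < d | j != i :> nat) j.+1%:R ^+ 2 <=
  2 * \prod_(j < d | j != i :> nat) `|i.+1%:R ^+ 2 - j.+1%:R ^+ 2| :> R.
Proof.
move=> ltid; have i0 : 0 < i.+1%:R ^+ 2 :> R by rewrite exprn_gt0.
rewrite -(ler_pM2l i0) prod_sqr // mulrA [_ * 2]mulrC prod_dist_sqr //.
by rewrite -natrX ler_nat -mulnn fact_sqr_le.
Qed.

(** The factor 6 ensures 2/(6i^2-1) <= (2/5)/i^2, whose sum over i >= 1 stays below 1. *)
Definition node (i : nat) : R := 6 * i.+1%:R ^+ 2.

Lemma node_inj : injective node.
Proof.
move=> i j /eqP; rewrite /node -!natrX -!natrM eqr_nat => /eqP; nia.
Qed.

(** At 0 the basis polynomial is a quotient of two products, in which the factors 6 cancel. *)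
Lemma lagrange_node_le d (i : 'I_d) : `|(tnth (d.-lagrange node) i).[0]| <= 2.
Proof.
have d0 : (0 < d)%N by case: d i => // -[].
rewrite lagrangeE //=; last exact: node_inj.
rewrite hornerM hornerC !horner_prod normrM normfV !normr_prod.
under eq_bigr do rewrite hornerXsubC.
under [X in _ * X]eq_bigr do rewrite hornerXsubC.
have -> : \prod_(j < d | j != i) `|node i - node j| =
   (\prod_(j < d | j != i) 6) *
   (\prod_(j < d | j != i :> nat) `|i.+1%:R ^+ 2 - j.+1%:R ^+ 2|) :> R.
  rewrite -big_split /=; apply: eq_bigr => j _.
  by rewrite /node -mulrBr normrM ger0_norm.
have -> : \prod_(j < d | j != i) `|0 - node j| =
   (\prod_(j < d | j != i) 6) * (\prod_(j < d | j != i :> nat) j.+1%:R ^+ 2) :> R.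
  rewrite -big_split /=; apply: eq_bigr => j _.
  by rewrite /node sub0r normrN ger0_norm // mulr_ge0 // exprn_ge0.
have n0 : 0 < \prod_(j < d | j != i) 6 :> R by apply: prodr_gt0.
have n1 : 0 < \prod_(j < d | j != i :> nat) `|i.+1%:R ^+ 2 - j.+1%:R ^+ 2| :> R.
  apply: prodr_gt0 => j ji; rewrite normr_gt0 subr_eq0 -!natrX eqr_nat eqn_exp2r //.
  by rewrite eqSS eq_sym.
by rewrite ler_pdivrMl ?mulr_gt0 // -mulrA ler_pM2l // mulrC prod_ratio_le2.
Qed.

Lemma sum_inv_sqr_lt2 d : \sum_(i < d) (i.+1%:R ^+ 2)^-1 < 2 :> R.
Proof.
case: d => [|d]; first by rewrite big_ord0.
(* Strengthened for the induction: 1/(x+1)^2 is at most 1/x - 1/(x+1). *)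
suff : \sum_(i < d.+1) (i.+1%:R ^+ 2)^-1 <= 2 - d.+1%:R^-1 :> R.
  by move/le_lt_trans; apply; rewrite gtrBl invr_gt0.
elim: d => [|d IH]; first by rewrite big_ord1 expr1n invr1; lra.
rewrite big_ord_recr /=; apply: le_trans (lerD IH (lexx _)) _.
have -> : d.+2%:R = d.+1%:R + 1 :> R by rewrite natr1.
have : 0 < d.+1%:R :> R by [].
move: (d.+1%:R : R) => x x0; rewrite -subr_ge0.
have -> : 2 - (x + 1)^-1 - (2 - x^-1 + ((x + 1) ^+ 2)^-1) =
  (x * (x + 1) ^+ 2)^-1.
  by field; rewrite !gt_eqF // addr_gt0.
by rewrite invr_ge0 mulr_ge0 ?exprn_ge0 ?addr_ge0 // ltW.
Qed.

(* With [p - p(1) = (X - 1) g], the values of [g] at the nodes [6 i^2] are at most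
   [1 / (6 i^2 - 1)], too small to interpolate [|g(0)| = 1] when the nodes are
   at most [m]. *)
Lemma jump_degree (p : {poly R}) (d m : nat) : (size p <= d.+1)%N ->
  `|p.[0] - p.[1]| = 1 ->
  (forall k, (k <= m)%N -> `|p.[k%:R] - p.[1]| <= 1) ->
  (m <= 6 * d ^ 2)%N.
Proof.
move=> sp jump bnd; rewrite leqNgt; apply/negP => ltm.
have /factor_theorem[g Eg] : root (p - p.[1]%:P) 1.
  by rewrite rootE !hornerE subrr.
have gE t : (t - 1) * g.[t] = p.[t] - p.[1].
  by have := congr1 (horner^~ t) Eg; rewrite !hornerE mulrC => ->.
have sg : (size g <= d)%N.
  have [->|g0] := eqVneq g 0; first by rewrite size_poly0.
  have : (size (p - p.[1]%:P)%R <= d.+1)%N.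
    apply: leq_trans (size_polyD _ _) _; rewrite geq_max sp size_polyN.
    by apply: leq_trans (size_polyC_leq1 _) _.
  by rewrite Eg size_Mmonic ?monicXsubC // size_XsubC addn2.
have g01 : `|g.[0]| = 1 by rewrite -jump -gE sub0r mulN1r normrN.
have [d0|d0] := posnP d.
  move: g01; rewrite d0 leqn0 size_poly_eq0 in sg.
  by rewrite (eqP sg) horner0 normr0 => /eqP; rewrite eq_sym oner_eq0.
have := congr1 (horner^~ 0) (lagrange_gen d0 node_inj sg).
rewrite horner_sum => E.
have : `|g.[0]| <= \sum_(i < d) (2 / 5) * (i.+1%:R ^+ 2)^-1.
  rewrite E; apply: le_trans (ler_norm_sum _ _ _) _; apply: ler_sum => i _.
  rewrite hornerM hornerC normrM.
  (* The node is an integer at most 6d^2 < m, so [bnd] applies to it, and node - 1 >= 5(i+1)^2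
     bounds [g] there. *)
  apply: (@le_trans _ _ (((5 * i.+1%:R ^+ 2)^-1) * 2)); last first.
    by rewrite invfM mulrAC [_ * 2]mulrC.
  apply: ler_pM => //; last exact: lagrange_node_le.
  have i2 : 1 <= i.+1%:R ^+ 2 :> R by rewrite -natrX ler1n expn_gt0.
  rewrite -[leRHS]mul1r ler_pdivlMr; last by apply: mulr_gt0 => //; lra.
  have := bnd (6 * i.+1 ^ 2)%N; rewrite natrM natrX -/(node i) -gE normrM.
  have /[swap]/[apply] : (6 * i.+1 ^ 2 <= m)%N.
    by apply: leq_trans (ltnW ltm); rewrite leq_mul2l leq_exp2r ?ltn_ord.
  apply: le_trans; rewrite mulrC; apply: ler_wpM2r => //.
  by rewrite ger0_norm /node; lra.
rewrite g01 -mulr_sumr; have := sum_inv_sqr_lt2 d; lra.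
Qed.

End Interpolation.

(** * Counting the sets of a layer by polynomials in its level [k] *)

Section Symmetrization.

Lemma disjoint_cardsU (T : finType) (A B : {set T}) :
  [disjoint A & B] -> #|A :|: B| = (#|A| + #|B|)%N.
Proof. by move=> dis; apply/eqP; rewrite leq_card_setU. Qed.

(** Removing [M0] from [S] leaves a subset of fixed size, hence a binomial count. Falling factorials
    avoid division and show the polynomial dependence on [k]. *)
Lemma card_layer_between (T : finType) (B M0 M1 : {set T}) k :
  M0 \subset B -> M1 \subset B -> [disjoint M0 & M1] -> (k <= #|B|)%N ->
  (#|[set S : {set T} | [&& S \subset B, #|S| == k, M0 \subset S & [disjoint M1 & S]]]|
     * #|B| ^_ (#|M0| + #|M1|) =
  'C(#|B|, k) * (k ^_ #|M0| * (#|B| - k) ^_ #|M1|))%N.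
Proof.
move=> s0 s1 dis lek.
have card01 : #|M0 :|: M1| = (#|M0| + #|M1|)%N by exact: disjoint_cardsU.
have le01 : (#|M0| + #|M1| <= #|B|)%N.
  by rewrite -card01 subset_leq_card // subUset s0.
set L := finset _.
have [ltk|le0] := ltnP k #|M0|.
  rewrite (ffact_small ltk) mul0n muln0.
  suff -> : L = set0 by rewrite cards0.
  apply/setP => S; rewrite !inE; apply/negP => /and4P[_ /eqP Sk /subset_leq_card].
  by rewrite Sk leqNgt ltk.
have disU (A0 A1 A2 : {set T}) :
    [disjoint A0 & A1 :|: A2] = [disjoint A0 & A1] && [disjoint A0 & A2].
  by rewrite -!setI_eq0 setIUr setU_eq0.
set L' := [set S : {set T} | S \subset B :\: (M0 :|: M1) & #|S| == (k - #|M0|)%N].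
have -> : #|L| = #|L'|.
  have <- : [set M0 :|: S | S in L'] = L.
    apply/setP => S; apply/imsetP/idP => [[S'] |]; rewrite !inE.
      rewrite subsetD disU => /andP[/and3P[S'B d0 d1] /eqP S'k] ->.
      rewrite subUset s0 S'B subsetUl disU [[disjoint M1 & M0]]disjoint_sym dis.
      rewrite [[disjoint M1 & S']]disjoint_sym d1 !andbT /=.
      by rewrite disjoint_cardsU 1?disjoint_sym // S'k subnKC.
    move=> /and4P[SB /eqP Sk M0S M1S]; exists (S :\: M0).
      rewrite !inE subsetD (subset_trans (subsetDl _ _) SB) disU.
      rewrite cardsDS // Sk eqxx andbT.
      rewrite [[disjoint _ & M1]]disjoint_sym (disjointWr (subsetDl _ _) M1S) andbT.
      by rewrite -setI_eq0 setDE -setIA [~: M0 :&: M0]setIC setICr setI0 eqxx.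
    by apply/setP => i; rewrite !inE; case: (boolP (i \in M0)) => /= [/(subsetP M0S)|].
  apply: card_in_imset => S1 S2; rewrite !inE !subsetD !disU.
  move=> /andP[/and3P[_ d1 _] _] /andP[/and3P[_ d2 _] _] /(congr1 (fun X => X :\: M0)).
  by rewrite !setDUl !setDv !set0U (setDidPl d1) (setDidPl d2).
rewrite cards_draws cardsDS ?subUset ?s0 // card01.
have [ltk|le1] := ltnP (#|B| - k) #|M1|.
  by rewrite [X in (_ * (_ * X))%N]ffact_small // !muln0 bin_small //; lia.
(* Multiplied by these factorials, both sides equal the factorial of [#|B|]. *)
have F : (0 < (k - #|M0|)`! * (#|B| - k - #|M1|)`!)%N by rewrite muln_gt0 !fact_gt0.
apply/eqP; rewrite -(eqn_pmul2r F); apply/eqP.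
have E1 : (#|B| - (#|M0| + #|M1|) - (k - #|M0|) = #|B| - k - #|M1|)%N by lia.
have := @bin_fact (#|B| - (#|M0| + #|M1|)) (k - #|M0|).
rewrite E1 mulnAC => ->; last by lia.
rewrite mulnC ffact_fact // -(bin_fact lek) -mulnA; congr (_ * _)%N.
by rewrite mulnACA !ffact_fact.
Qed.

Variable R : realFieldType.

(** For [k < b] both sides vanish, the right one by its factor at [i = k]. *)
Lemma ffact_natr (k b : nat) : (k ^_ b)%:R = \prod_(i < b) (k%:R - i%:R) :> R.
Proof.
elim: b => [|b IH]; first by rewrite big_ord0.
rewrite ffactnSr big_ord_recr /= natrM -IH; have [lekb|ltkb] := leqP b k.
  by rewrite natrB.
by rewrite ffact_small // !mul0r.
Qed.

Lemma size_prod_linear b (F : 'I_b -> {poly R}) :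
  (forall i, size (F i) <= 2)%N -> (size (\prod_(i < b) F i)%R <= b.+1)%N.
Proof.
elim: b F => [|b IH] F sF; first by rewrite big_ord0 size_poly1.
rewrite big_ord_recr /=; apply: leq_trans (size_polyMleq _ _) _.
have := IH _ (fun i => sF (widen_ord (leqnSn b) i)); have := sF ord_max.
by move: (size _) (size _) => u v; lia.
Qed.

Lemma layer_between_poly (T : finType) (B M0 M1 : {set T}) :
  M0 \subset B -> M1 \subset B -> [disjoint M0 & M1] ->
  exists2 q : {poly R}, (size q <= (#|M0| + #|M1|).+1)%N &
    forall k, (k <= #|B|)%N ->
    #|[set S : {set T} | [&& S \subset B, #|S| == k, M0 \subset S & [disjoint M1 & S]]]|%:R
      = 'C(#|B|, k)%:R * q.[k%:R].
Proof.
move=> s0 s1 dis.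
have le01 : (#|M0| + #|M1| <= #|B|)%N.
  rewrite -disjoint_cardsU //.
  by rewrite subset_leq_card // subUset s0.
pose q0 : {poly R} := \prod_(i < #|M0|) ('X - i%:R%:P).
pose q1 : {poly R} := \prod_(i < #|M1|) ((#|B|%:R - i%:R)%:P - 'X).
exists ((#|B| ^_ (#|M0| + #|M1|))%:R^-1 *: (q0 * q1)).
  apply: leq_trans (size_scale_leq _ _) _; apply: leq_trans (size_polyMleq _ _) _.
  have : (size q0 <= #|M0|.+1)%N.
    by apply: size_prod_linear => i; rewrite size_XsubC.
  have : (size q1 <= #|M1|.+1)%N.
    by apply: size_prod_linear => i; rewrite -opprB size_polyN size_XsubC.
  by lia.
move=> k lek; have nz : (#|B| ^_ (#|M0| + #|M1|))%:R != 0 :> R.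
  by rewrite pnatr_eq0 -lt0n ffact_gt0.
apply: (mulIf nz); rewrite -natrM card_layer_between // !natrM hornerZ hornerM.
have -> : q0.[k%:R] = (k ^_ #|M0|)%:R.
  by rewrite ffact_natr horner_prod; apply: eq_bigr => i _; rewrite !hornerE.
have -> : q1.[k%:R] = ((#|B| - k) ^_ #|M1|)%:R.
  rewrite ffact_natr horner_prod; apply: eq_bigr => i _.
  by rewrite !hornerE natrB // addrAC.
by rewrite -mulrA [_^-1 * _]mulrC mulfVK.
Qed.

End Symmetrization.

(** * Sensitivity is at most six times the squared degree *)

Section Degree.
Variables (R : realType) (n : nat).
Implicit Types (f : input n -> bool) (x : input n) (B : {set 'I_n}).

(** On the cube a monomial tests that the bits of its support are 1. At [flip x S] this means that
    [S] contains the support bits in [B] that are 0 in [x] and avoids those that are 1. *)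
Lemma monomial_layer_poly x B (mon : 'X_{1..n}) :
  exists2 q : {poly R}, (size q <= (mdeg mon).+1)%N &
    forall k, (k <= #|B|)%N ->
    \sum_(S : {set 'I_n} | (S \subset B) && (#|S| == k))
      \prod_i cube_point R (flip x S) i ^+ mon i = 'C(#|B|, k)%:R * q.[k%:R].
Proof.
pose M := [set i | (0 < mon i)%N].
have in_M i : (i \in M) = (0 < mon i)%N by rewrite inE.
have leM : (#|M| <= mdeg mon)%N.
  rewrite mdegE -sum1_card big_mkcond; apply: leq_sum => i _.
  by rewrite inE; case: ifP.
have prodE y : \prod_i cube_point R y i ^+ mon i = [forall i in M, y i]%:R.
  have [/forall_inP yM|] := boolP [forall i in M, y i].
    rewrite big1 // => i _; have [->|mi] := posnP (mon i); first by rewrite expr0.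
    by rewrite /cube_point yM ?inE // expr1n.
  case/forall_inPn => i; rewrite inE => mi /negPf yi.
  by rewrite (bigD1 i) //= /cube_point yi expr0n (gtn_eqF mi) mul0r.
(* A support bit outside [B] that is 0 in [x] is never flipped, so the sum is 0. *)
have [/exists_inP[i iM /andP[iB xi]]|none] := boolP [exists i in M, (i \notin B) && ~~ x i].
  exists 0; first by rewrite size_poly0.
  move=> k _; rewrite horner0 mulr0 big1 // => S /andP[/subsetP SB _].
  rewrite prodE; case: forall_inP => // /(_ i iM).
  by rewrite ffunE (negPf xi) addbF => /SB; rewrite (negPf iB).
pose M0 := [set i in M :&: B | ~~ x i]; pose M1 := [set i in M :&: B | x i].
have sMB (b : pred 'I_n) : [set i in M :&: B | b i] \subset B.
  by apply/subsetP => i; rewrite !inE -andbA => /and3P[].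
have dis : [disjoint M0 & M1].
  rewrite -setI_eq0; apply/eqP/setP => i; rewrite !inE.
  by case: (x i); rewrite !(andbF, andFb).
have [q sq qE] := layer_between_poly R (sMB _) (sMB _) dis.
exists q => [|k lek].
  apply: leq_trans sq _; rewrite ltnS; apply: leq_trans leM.
  rewrite -disjoint_cardsU //.
  by apply/subset_leq_card/subsetP => i; rewrite !inE; case: (0 < mon i)%N.
rewrite -qE // -sum1_card natr_sum big_mkcond [RHS]big_mkcond /=.
apply: eq_bigr => S _; rewrite inE andbA; case: (boolP (_ && _)) => //= /andP[/subsetP SB _].
rewrite prodE.
have -> : [forall i in M, flip x S i] = (M0 \subset S) && [disjoint M1 & S].
  apply/forall_inP/andP => [H | [/subsetP M0S M1S] i iM].
    split; first apply/subsetP => i.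
      rewrite !inE -andbA => /and3P[iM _ xi]; have := H i.
      by rewrite inE iM ffunE (negPf xi) addbF; apply.
    rewrite disjoint_subset; apply/subsetP => i; rewrite !inE -andbA => /and3P[iM _ xi].
    by have := H i; rewrite inE iM ffunE xi addbT; apply.
  rewrite ffunE; have [iB|iB] := boolP (i \in B); last first.
    have -> : i \in S = false by apply: contraNF iB => /SB.
    by move/exists_inPn: none => /(_ i iM); rewrite iB /= negbK.
  case xi: (x i); first by rewrite addbT (disjointFr M1S) // inE !inE iB xi -in_M iM.
  by rewrite addbF; apply: M0S; rewrite inE !inE iB xi -in_M iM.
by case: ifP.
Qed.

(** [q] at [k] is the average of [f] over the flips of [k] bits of [B], obtained by linearity from
    the monomials. *)
Lemma layer_poly f x B :
  exists2 q : {poly R}, (size q <= (deg R f).+1)%N &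
    forall k, (k <= #|B|)%N ->
    \sum_(S : {set 'I_n} | (S \subset B) && (#|S| == k)) (f (flip x S))%:R =
      'C(#|B|, k)%:R * q.[k%:R].
Proof.
have /andP[_ /forallP fE] := mlpolyP R f.
pose ok (mon : 'X_{1..n}) (q : {poly R}) := (size q <= (mdeg mon).+1)%N /\
  forall k, (k <= #|B|)%N ->
    \sum_(S : {set 'I_n} | (S \subset B) && (#|S| == k))
      \prod_i cube_point R (flip x S) i ^+ mon i = 'C(#|B|, k)%:R * q.[k%:R].
have /choice[Q QP] : forall mon, exists q, ok mon q.
  by move=> mon; have [q] := monomial_layer_poly x B mon; exists q.
have sQ mon := (QP mon).1; have QE mon := (QP mon).2.
exists (\sum_(mon <- msupp (mlpoly R f)) (mlpoly R f)@_mon *: Q mon).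
  rewrite big_seq; apply: (big_ind (fun q : {poly R} => size q <= (deg R f).+1)%N).
  - by rewrite size_poly0.
  - by move=> p q sp sq; apply: leq_trans (size_polyD _ _) _; rewrite geq_max sp.
  move=> mon /msize_mdeg_lt lt; apply: leq_trans (size_scale_leq _ _) _.
  by apply: leq_trans (sQ mon) _; rewrite ltnS /deg; case: (msize _) lt.
move=> k lek; rewrite horner_sum mulr_sumr.
under eq_bigr do rewrite -(eqP (fE _)) mevalE.
rewrite exchange_big /=; apply: eq_bigr => mon _.
by rewrite -mulr_sumr QE // hornerZ mulrCA.
Qed.

Lemma sensitive_bits_le_deg f x B :
  (forall i, i \in B -> sensitive_block f x [set i]) -> (#|B| <= 6 * deg R f ^ 2)%N.
Proof.
move=> sens; have [->//|B0] := posnP #|B|.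
have [q sq qE] := layer_poly f x B.
have const k (v : bool) : (k <= #|B|)%N ->
    (forall S : {set 'I_n}, S \subset B -> #|S| = k -> f (flip x S) = v) -> q.[k%:R] = v%:R.
  move=> lek fv; have nz : 'C(#|B|, k)%:R != 0 :> R by rewrite pnatr_eq0 -lt0n bin_gt0.
  apply: (mulfI nz); rewrite -qE // (eq_bigr (fun=> v%:R)) => [|S /andP[SB /eqP Sk]].
    rewrite sumr_const mulr_natl -cards_draws; congr (_ *+ _).
    by apply: eq_card => S; rewrite !inE.
  by rewrite fv.
have q0 : q.[0] = (f x)%:R.
  apply: (const 0%N) => // S _ /cards0_eq ->; congr f.
  by apply/ffunP => i; rewrite ffunE inE.
(* Every flip of a single bit of [B] changes [f], and level 1 exists as [B] is nonempty. *)
have q1 : q.[1] = (~~ f x)%:R.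
  apply: (const 1%N) => // S SB /eqP/cards1P[i Si].
  have /sens : i \in B by apply: (subsetP SB); rewrite Si set11.
  by rewrite Si /sensitive_block; case: (f x); case: (f _).
have q01 k : (k <= #|B|)%N -> 0 <= q.[k%:R] <= 1.
  move=> lek; have C0 : 0 < 'C(#|B|, k)%:R :> R by rewrite ltr0n bin_gt0.
  rewrite -(pmulr_rge0 _ C0) -[X in _ && X](ler_pM2l C0) -(qE _ lek) sumr_ge0 //= mulr1.
  rewrite -cards_draws -sum1_card natr_sum.
  rewrite big_mkcond [leRHS]big_mkcond; apply: ler_sum => S _; rewrite inE.
  by case: ifP => // _; rewrite lern1 leq_b1.
apply: (jump_degree sq) => [|k /q01/andP[ge0 le1]].
  by rewrite q0 q1; case: (f x); rewrite /= ?subr0 ?sub0r ?normrN normr1.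
by rewrite q1 ler_norml; case: (f x) => /=; apply/andP; split; lra.
Qed.

End Degree.

Theorem theorem2 (R : realType) :
  exists c : R, 0 < c /\
    forall (n : nat) (f : input n -> bool), zebra f ->
      (D f)%:R <= c * (bs f)%:R ^+ 2 /\
      (C f)%:R <= c * (deg R f)%:R ^+ 2.
Proof.
(* 12 = 2 * 6 comes from the degree bound; the argument for [D f] gives 2. *)
exists 12; split=> // n f zf; rewrite -!natrX -!natrM !ler_nat; split.
  apply: leq_trans (D_le_C_bs f) _; rewrite -mulnn mulnA leq_mul2r; apply/orP; right.
  apply: leq_trans (zebra_C_le zf (@sensitive_bits_le_bs n f)) _.
  by rewrite leq_mul2r orbT.
apply: leq_trans (zebra_C_le zf (@sensitive_bits_le_deg R n f)) _.
by rewrite mulnA.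
Qed.
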